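(* Let $n\ge 4$ and $1\le p\le n-3$ be integers, let $m=\lfloor \frac{2n-p}{n-p}\rfloor$ and $t=2n-p-m(n-p)$, and let $f:[1,\infty)\to\mathbb{R}$ be a function whose restriction to $[2,\infty)$ is concave. Then for every unicyclic graph $G$ with $n$ vertices and exactly $p$ pendant vertices, $$ f(p+2) + (n-p-1) f(2) + p f(1) \le I_f(G) \le t f(m+1) + (n-p-t) f(m) + p f(1), $$ and both inequalities are attained (i.e., for each such $n,p,f$, each of the two bounds is equal to $I_f(G)$ for some unicyclic graph $G$ with $n$ vertices and $p$ pendant vertices).
   Context: All graphs are finite, connected, simple (no loops, no multiple edges) and have at least one edge. A unicyclic graph is a graph containing exactly one cycle. A vertex is pendant if it has degree $1$. For a vertex $u$ of $G$, $d_u$ denotes its degree. For a function $f:[1,\infty)\to\mathbb{R}$, $I_f(G) = \sum_{u\in V(G)} f(d_u)$. *)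

(* Defs.v *)
From HB Require Import structures.
From mathcomp Require Import all_boot all_order all_algebra.
From mathcomp Require Import all_classical all_reals all_analysis.

Set Implicit Arguments.
Unset Strict Implicit.
Unset Printing Implicit Defensive.

Import Order.TTheory GRing.Theory Num.Theory.

Local Open Scope ring_scope.

(* Finite simple graphs, always connected and with at least one edge. *)
Record graph := Graph {
  vertex :> finType;
  adj : rel vertex;
  adj_sym : symmetric adj;
  adj_irrefl : irreflexive adj;
  adj_connected : forall x y : vertex, connect adj x y;
  adj_nonempty : exists x y : vertex, adj x y
}.

Definition order_of (G : graph) : nat := #|[set: G]|.

Definition deg (G : graph) (u : G) : nat := #|[set v : G | adj u v]|.

Definition pendant (G : graph) : {set G} := [set u : G | deg u == 1%N].

(* A cycle is identified with its edge set (a set of unordered pairs of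
   vertices), so that the rotations and reflections of a cyclic sequence of
   vertices all describe the same cycle. *)
Definition is_cycle (G : graph) (C : {set {set G}}) : Prop :=
  exists c : seq G,
    [/\ (2 < size c)%N, ucycle (@adj G) c
      & C = [set [set x; next c x] | x in c] ].

Definition unicyclic (G : graph) : Prop :=
  exists! C : {set {set G}}, is_cycle C.

Definition concave_function (R : realType) (D : set R) (f : R -> R) : Prop :=
  convex_function (E := R^o) D (fun x => - f x).

(* Only the values of f at integers >= 1 matter, since the graphs are
   connected and have an edge. *)
Definition If (R : realType) (f : R -> R) (G : graph) : R :=
  \sum_(u : G) f (deg u)%:R.

(* Main.v *)
(* In a unicyclic graph the map sending each vertex of the cycle to its
   successor and every other vertex to a neighbour closer to the cycle
   identifies vertices with edges: its graph is connected, so an edge it misses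
   would close a second cycle.  Hence the degrees sum to 2n, and the degrees of
   the n - p non-pendant vertices are at least 2 with sum 2n - p.  The lower
   bound compares f with its chord over [2, p + 2], the upper one with its
   secant through m and m + 1.  Both are attained by a cycle of length n - p
   with p pendant vertices, all attached to one vertex of the cycle or
   distributed evenly along it. *)
Require Import Defs.
From HB Require Import structures.
From mathcomp Require Import all_boot all_order all_algebra.
From mathcomp Require Import all_classical all_reals all_analysis.
From mathcomp Require Import zify ring lra.

Set Implicit Arguments.
Unset Strict Implicit.
Unset Printing Implicit Defensive.

Import Order.TTheory GRing.Theory Num.Theory.
Local Open Scope ring_scope.

(** * Parent maps and the degree sum of a unicyclic graph *)

(** Take for [d x] the length of a shortest path from [x] into [A]: its first step lowers [d]. *)
Lemma connect_descent (T : finType) (e : rel T) (A : {pred T}) (a : T) :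
  a \in A -> (forall x y, connect e x y) ->
  exists d : T -> nat,
    forall x, x \notin A -> exists2 y, e x y & (d y < d x)%N.
Proof.
move=> Aa con_e.
pose P x n := [exists t : n.-tuple T, path e x t && (last x t \in A)].
have exP x : exists n, P x n.
  have /connectP[s e_s def_a] := con_e x a.
  exists (size s); apply/existsP; exists (in_tuple s).
  by rewrite e_s -def_a.
exists (fun x => ex_minn (exP x)) => x nAx.
case: (ex_minnP (exP x)) => n /existsP[t /andP[]] + + _.
case: t => -[|y s] /= /eqP <- {n}; first by rewrite (negPf nAx).
case/andP=> e_xy e_s A_s; exists y => //.
case: ex_minnP => k _; apply; apply/existsP.
by exists (in_tuple s); rewrite e_s.
Qed.

Lemma prev_head (T : eqType) (x : T) (s : seq T) :
  uniq (x :: s) -> prev (x :: s) x = last x s.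
Proof.
case/andP=> nsx _; rewrite prev_nth mem_head -[last x s](nth_last x (x :: s)).
by rewrite (memNindex nsx).
Qed.

(** Close a duplicate-free [e]-path from [x] to [y] by the edge [yx]. It has a third vertex, since
    [x] and [y] differ and are not [e]-adjacent. *)
Lemma chord_cycle (G : graph) (e : rel G) (x y : G) :
  subrel e (@adj G) -> connect e x y -> adj x y -> ~~ e x y ->
  exists c : seq G, [/\ (2 < size c)%N, ucycle (@adj G) c
    & [set x; y] \in [set [set z; next c z] | z in c]].
Proof.
move=> sub_e /connectP[s0 /shortenP[s e_s uniq_s _] def_y] adj_xy ne_xy.
have next_y : next (x :: s) y = x.
  by rewrite def_y -(prev_head uniq_s) next_prev.
exists (x :: s); split.
- case: s e_s def_y {uniq_s next_y} => [|z [|z' s]] //= => [_ def_y|].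
    by rewrite def_y adj_irrefl in adj_xy.
  by rewrite andbT => e_xz def_y; rewrite def_y e_xz in ne_xy.
- rewrite /ucycle uniq_s andbT /= rcons_path -def_y adj_sym adj_xy andbT.
  exact: sub_path e_s.
- apply/imsetP; exists y; first by rewrite def_y mem_last.
  by rewrite next_y finset.setUC.
Qed.

Lemma next_next_neq (T : eqType) (c : seq T) (x : T) :
  (2 < size c)%N -> uniq c -> x \in c -> next c (next c x) != x.
Proof.
move=> c_gt2 uniq_c c_x; case: (rot_to c_x) => i s def_c.
rewrite -!(next_rot i uniq_c).
rewrite -(size_rot i) in c_gt2; rewrite -(rot_uniq i) in uniq_c.
rewrite def_c in c_gt2 uniq_c *.
case: s c_gt2 uniq_c {def_c} => [|y [|z s]] //= _; rewrite !inE !negb_or.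
case/and4P=> /and3P[xy xz xs] /andP[yz ys] _ _.
by rewrite eqxx /= [y == x]eq_sym (negPf xy) eqxx eq_sym.
Qed.

(** The condition [par (par x) != x] says that no edge arises from both its ends, so sending [x] to
    [{x, par x}] is a bijection from vertices onto edges. *)
Lemma unicyclic_parent (G : graph) :
  unicyclic G -> exists par : G -> G,
    (forall x, par (par x) != x) /\
    (forall x y, adj x y = (par x == y) || (par y == x)).
Proof.
case=> C [[c [c_gt2 cyc_c def_C]] uniqC].
have uniq_c : uniq c by case/andP: cyc_c.
have [a ca] : exists a, a \in c.
  by case: c c_gt2 {cyc_c def_C uniq_c} => // a c _; exists a; rewrite mem_head.
have [d d_lt] := connect_descent ca (@adj_connected G).
(* The default [x] is never taken: [d_lt] provides a suitable neighbour off the cycle. *)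
pose par x := if x \in c then next c x
              else odflt x [pick y | adj x y && (d y < d x)%N].
have par_out x : x \notin c -> adj x (par x) /\ (d (par x) < d x)%N.
  move=> ncx; rewrite /par (negPf ncx); case: pickP => [y /andP[]//|].
  by have [y adj_xy dyx] := d_lt x ncx => /(_ y); rewrite adj_xy dyx.
have par_in x : x \in c -> par x = next c x by rewrite /par => ->.
have adj_par x : adj x (par x).
  case cx: (x \in c); last by case: (par_out x (negbT cx)).
  by rewrite par_in //; apply: next_cycle cx; case/andP: cyc_c.
pose e := [rel x y | (par x == y) || (par y == x)].
have sub_e : subrel e (@adj G).
  by move=> x y /orP[/eqP<-|/eqP<-]; rewrite // adj_sym.
have sym_e : symmetric e by move=> x y; rewrite /= orbC.
(* Off the cycle [par] lowers [d], whence the induction; on the cycle, iterating [next c] reaches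
   [a]. *)
have con_a x : connect e x a.
  have [k] := ubnP (d x); elim: k x => // k IHk x; rewrite ltnS => dxk.
  case cx: (x \in c).
    have: fconnect (next c) x a by rewrite (fconnect_cycle (cycle_next _)).
    case/connectP=> s + ->; elim: s x cx {dxk} => //= y s IHs x cx.
    case/andP=> /eqP <- /IHs; rewrite mem_next => /(_ cx).
    by apply: connect_trans; apply: connect1; rewrite /= par_in ?eqxx.
  have [_ d_par] := par_out x (negbT cx).
  apply: (@connect_trans _ _ (par x)); first by rewrite connect1 /= ?eqxx.
  exact/IHk/(leq_trans d_par).
have con_e x y : connect e x y.
  by rewrite (connect_trans (con_a x)) // sym_connect_sym.
exists par; split=> [x|x y].
  (* Three cases: the cycle is too short to return only if its length is at most 2; once on the
     cycle [par] never leaves it; otherwise [d] drops twice. *)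
  case cx: (x \in c); first by rewrite !par_in ?mem_next // next_next_neq.
  have [_ d_par] := par_out x (negbT cx).
  case cy: (par x \in c).
    by apply: contraFneq cx => <-; rewrite (par_in _ cy) mem_next.
  have [_ d_par2] := par_out (par x) (negbT cy).
  by apply: contraTneq (ltn_trans d_par2 d_par) => ->; rewrite ltnn.
apply/idP/idP=> [adj_xy|]; last exact: sub_e.
apply/negPn/negP=> ne_xy.
(* A missed edge lies on some cycle, which must be [C]; but every edge of [C] has the form
   [{z, par z}]. *)
have [c' [c'_gt2 cyc_c' c'xy]] := chord_cycle sub_e (con_e x y) adj_xy ne_xy.
have /uniqC def_C' : is_cycle [set [set z; next c' z] | z in c'] by exists c'.
move: c'xy; rewrite -def_C' def_C => /imsetP[z cz].
rewrite -par_in // => /setP def_xy.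
have := def_xy (par z); have := def_xy z; move: ne_xy (adj_par z) adj_xy.
have := def_xy y; have := def_xy x.
rewrite !inE !eqxx ?orbT /=.
(* Each of [x] and [y] is [z] or [par z]: either they coincide, or they are [e]-adjacent. *)
move=> /esym/orP[]/eqP-> /esym/orP[]/eqP->; rewrite ?eqxx ?orbT ?adj_irrefl //.
Qed.

Lemma degE (G : graph) (u : G) : deg u = (\sum_(v : G) adj u v)%N.
Proof. by rewrite /deg cardsE -sum1_card big_mkcond. Qed.

(** The two disjuncts describing adjacency exclude each other, so it is a sum of two indicators,
    each with total the number of vertices. *)
Lemma sum_deg_unicyclic (G : graph) :
  unicyclic G -> (\sum_(u : G) deg u)%N = (2 * order_of G)%N.
Proof.
case/unicyclic_parent=> par [par2 adjE].
have ->: (\sum_(u : G) deg u =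
    \sum_(u : G) \sum_(v : G) ((par u == v) + (par v == u)))%N.
  apply: eq_bigr => u _; rewrite degE; apply: eq_bigr => v _; rewrite adjE.
  have := par2 u.
  by case: (eqVneq (par u) v) => [<- /negPf->|_ _]; rewrite ?add0n.
under eq_bigr do rewrite big_split /=.
rewrite big_split /= [X in (_ + X)%N]exchange_big /= mul2n -addnn.
have sum_par u : (\sum_(v : G) (par u == v) = 1)%N.
  rewrite (bigD1 (par u)) //= eqxx big1 ?addn0 // => v.
  by rewrite eq_sym => /negPf->.
by under eq_bigr do rewrite sum_par; rewrite sum1_card /order_of cardsT.
Qed.

Lemma deg_gt0 (G : graph) (u : G) : (0 < deg u)%N.
Proof.
have [a [b adj_ab]] := adj_nonempty G.
have [v] : exists v, v != u.
  exists (if a == u then b else a); case: (eqVneq a u) => // au.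
  by apply: contraTneq adj_ab => ->; rewrite au adj_irrefl.
have /connectP[[|w s] /= + ->] := adj_connected u v; first by rewrite eqxx.
case/andP=> adj_uw _ _; apply/card_gt0P; exists w; by rewrite inE.
Qed.

(** * Concavity bounds for sums with prescribed total *)

(** Denominators are cleared so that later uses are within reach of [lra]. *)
Lemma concave_chord (R : realType) (D : set R) (f : R -> R) (a x b : R) :
  concave_function D f -> D a -> D b -> a <= x <= b -> a < b ->
  (b - x) * f a + (x - a) * f b <= (b - a) * f x.
Proof.
move=> conc_f Da Db /andP[ax xb] ab.
have ba_gt0 : 0 < b - a by rewrite subr_gt0.
pose t := (b - x) / (b - a).
have t_ge0 : 0 <= t by rewrite divr_ge0 ?subr_ge0 // ltW.
have t_le1 : t <= 1 by rewrite ler_pdivrMr // mul1r lerD2l lerN2.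
have /(_ a b) := conc_f (Itv01 t_ge0 t_le1).
rewrite !inE => /(_ Da Db); rewrite !convRE /=.
rewrite [X in - f X <= _](_ : _ = x); last first.
  transitivity (t * a + (1 - t) * b); first by [].
  by rewrite /t; field; rewrite gt_eqF.
rewrite -(ler_pM2l ba_gt0) /unstable.onem.
have -> : (b - a) * (t * - f a + (1 - t) * - f b) =
    - ((b - x) * f a + (x - a) * f b).
  by rewrite /t; field; rewrite gt_eqF.
by rewrite mulrN lerN2.
Qed.

Section ConcaveSum.
Variables (R : realType) (f : R -> R) (I : finType) (P : {pred I}).
Variable d : I -> nat.
Hypotheses (conc_f : concave_function `[2, +oo[%classic f).
Hypothesis d_ge2 : forall i, i \in P -> (2 <= d i)%N.

Let ge2_itv k : (2 <= k)%N -> `[2, +oo[%classic (k%:R : R).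
Proof. by move=> k2; rewrite /= in_itv /= andbT (ler_nat R 2). Qed.

(** On [[2, p + 2]] the function lies above its chord, and the sum of an affine function depends
    only on the sum of the [d i]. *)
Lemma concave_sum_ge (p : nat) :
  (0 < p)%N -> (\sum_(i in P) d i = 2 * #|P| + p)%N ->
  f (p + 2)%:R + (#|P| - 1)%:R * f 2 <= \sum_(i in P) f (d i)%:R.
Proof.
move=> p_gt0 sum_d.
have P_gt0 : (0 < #|P|)%N.
  rewrite lt0n; apply: contra_neqN (lt0n_neq0 p_gt0) => /eqP P0.
  by move: sum_d; rewrite P0 (eq_bigl _ _ (card0_eq P0)) big_pred0_eq.
(* The excesses over 2 add up to [p], so no single one is larger than [p]. *)
have sum_excess : (\sum_(i in P) (d i - 2) = p)%N.
  by rewrite sumnB // sum_d sum_nat_const mulnC addKn.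
have d_le i : i \in P -> (d i <= p + 2)%N.
  by move=> Pi; rewrite addnC -leq_subLR -sum_excess (bigD1 i) //= leq_addr.
have chord i : i \in P ->
    (f 2 * p%:R - 2 * (f (p + 2)%:R - f 2)) + (d i)%:R * (f (p + 2)%:R - f 2)
      <= p%:R * f (d i)%:R.
  move=> Pi; have := @concave_chord _ _ _ 2 (d i)%:R (p + 2)%:R conc_f
    (ge2_itv (leqnn 2)) (ge2_itv (leq_addl p 2)).
  rewrite (ler_nat R 2) d_ge2 // ler_nat d_le //= (ltr_nat R 2) -addn1 addnC.
  rewrite leq_add2r p_gt0 => /(_ isT isT); rewrite natrD; lra.
have p_gt0R : (0 : R) < p%:R by rewrite ltr0n.
rewrite -(ler_pM2l p_gt0R) mulr_sumr.
apply: le_trans (ler_sum _ chord); rewrite big_split /= sumr_const -mulr_suml.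
rewrite -natr_sum sum_d (natrD _ (_ * _)) natrM natrB // -mulr_natl; lra.
Qed.

Lemma concave_sum_le (m t : nat) :
  (2 <= m)%N -> (t <= #|P|)%N -> (\sum_(i in P) d i = m * #|P| + t)%N ->
  \sum_(i in P) f (d i)%:R <= t%:R * f (m + 1)%:R + (#|P| - t)%:R * f m%:R.
Proof.
move=> m_ge2 t_le sum_d.
have m1_ge2 : (2 <= m + 1)%N by rewrite ltn_addr.
have m_lt : (m%:R : R) < (m + 1)%:R by rewrite ltr_nat addn1.
have chord i : i \in P ->
    f (d i)%:R <= (f m%:R - m%:R * (f (m + 1)%:R - f m%:R))
      + (d i)%:R * (f (m + 1)%:R - f m%:R).
  (* No integer lies strictly between [m] and [m + 1]. If [d i <= m], use concavity at [m], between
     [d i] and [m + 1]; otherwise at [m + 1], between [m] and [d i]. *)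
  move=> Pi; have di2 := d_ge2 Pi; have [d_le|d_gt] := leqP (d i) m.
    have := concave_chord conc_f (ge2_itv di2) (ge2_itv m1_ge2) (x := m%:R).
    rewrite !ler_nat d_le leq_addr ltr_nat addn1 ltnS d_le -addn1.
    move=> /(_ isT isT); rewrite natrD; lra.
  have := concave_chord conc_f (ge2_itv m_ge2) (ge2_itv di2) (x := (m + 1)%:R).
  rewrite !ler_nat leq_addr addn1 ltr_nat d_gt -addn1.
  move=> /(_ isT isT); rewrite natrD; lra.
apply: le_trans (ler_sum _ chord) _; rewrite big_split /= sumr_const.
rewrite -mulr_suml -natr_sum sum_d (natrD _ (_ * _)) natrM natrB //.
rewrite -mulr_natl; lra.
Qed.

End ConcaveSum.

(** * The extremal graphs: a cycle with pendant vertices *)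

Section Sun.
Variables (k p : nat) (g : 'I_p -> 'I_k.+3).

(** Addition in ['I_k.+3] is modulo [k + 3], which closes the cycle; the pendant vertex [a] hangs at
    [g a]. *)
Definition sun_adj (u v : 'I_k.+3 + 'I_p) : bool :=
  match u, v with
  | inl i, inl j => (j == i + 1) || (i == j + 1)
  | inl i, inr a | inr a, inl i => g a == i
  | inr _, inr _ => false
  end.

Lemma sun_adj_sym : symmetric sun_adj.
Proof. by case=> [i|a] [j|b] //=; rewrite orbC. Qed.

Lemma sun_adj_irrefl : irreflexive sun_adj.
Proof.
by case=> [i|a] //=; rewrite orbb -subr_eq0 opprD addNKr oppr_eq0.
Qed.

Lemma sun_connected (u v : 'I_k.+3 + 'I_p) : connect sun_adj u v.
Proof.
suff con0 w : connect sun_adj (inl 0) w.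
  rewrite (connect_trans _ (con0 v)) // sym_connect_sym //.
  exact: sun_adj_sym.
(* Every residue is the image of a natural number, which allows induction around the cycle. *)
have con_nat (l : nat) : connect sun_adj (inl 0) (inl l%:R).
  elim: l => // l IHl; apply: connect_trans IHl (connect1 _).
  by rewrite /= -natr1 eqxx.
have con_inl i : connect sun_adj (inl 0) (inl i) by rewrite -(natr_Zp i).
case: w => [//|a]; apply: connect_trans (con_inl (g a)) (connect1 _).
by rewrite /= eqxx.
Qed.

Lemma sun_nonempty : exists u v, sun_adj u v.
Proof. by exists (inl 0), (inl 1); apply/orP; left; rewrite add0r. Qed.

Definition sun : graph :=
  Graph sun_adj_sym sun_adj_irrefl sun_connected sun_nonempty.

(** The difference is 2, nonzero modulo [k + 3]. *)
Lemma succ_neq_pred (i : 'I_k.+3) : i + 1 != i - 1.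
Proof. by rewrite -subr_eq0 opprB addrC addrA subrK -(natrD _ 1 1). Qed.

Lemma deg_sun_inl (i : 'I_k.+3) :
  deg (inl i : sun) = (2 + \sum_(a < p) (g a == i))%N.
Proof.
rewrite degE big_sumType /=; congr (_ + _)%N.
transitivity #|[set i + 1; i - 1]|; last by rewrite cards2 succ_neq_pred.
rewrite -sum1_card [RHS]big_mkcond; apply: eq_bigr => j _.
by rewrite !inE -[i == _]subr_eq [i - 1 == j]eq_sym; case: (_ || _).
Qed.

Lemma deg_sun_inr (a : 'I_p) : deg (inr a : sun) = 1%N.
Proof.
rewrite degE big_sumType /= [X in (_ + X)%N]big1 // addn0.
by rewrite (bigD1 (g a)) //= eqxx big1 // => j; rewrite eq_sym => /negPf->.
Qed.

Lemma sun_cycle_edges (c : seq sun) : (2 < size c)%N -> ucycle sun_adj c ->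
  [set [set x; next c x] | x in c] =
  [set [set (inl i : sun); inl (i + 1)] | i in 'I_k.+3].
Proof.
move=> c_gt2 /andP[cyc_c uniq_c].
have next_adj x : x \in c -> sun_adj x (next c x) by apply: next_cycle.
have prev_adj x : x \in c -> sun_adj x (prev c x).
  by move=> cx; rewrite sun_adj_sym prev_cycle.
have next_neq x : x \in c -> next c x != prev c x.
  move=> cx; have := @next_next_neq _ c (prev c x) c_gt2 uniq_c.
  by rewrite mem_prev next_prev // => /(_ cx).
(* On a cycle the two neighbours of a vertex differ, but a pendant vertex has only one. *)
have c_inr a : inr a \notin c.
  apply/negP=> ca; have := next_adj _ ca; have := prev_adj _ ca.
  have := next_neq _ ca; case: (next c _) (prev c _) => [i|?] [j|?] //=.
  by move=> neq_ij /eqP gj /eqP gi; rewrite -gi -gj eqxx in neq_ij.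
(* [b] records the direction in which [c] runs through [i]. *)
have c_inl i : inl i \in c -> exists2 b : bool,
    next c (inl i) = inl (if b then i + 1 else i - 1) &
    prev c (inl i) = inl (if b then i - 1 else i + 1).
  move=> ci; have := next_adj _ ci; have := prev_adj _ ci.
  have := next_neq _ ci.
  have: next c (inl i) \in c by rewrite mem_next.
  have: prev c (inl i) \in c by rewrite mem_prev.
  case: (next c _) (prev c _) => [j|a] [l|b];
    rewrite ?(negPf (c_inr _)) //= => _ _.
  have pred_eq h : (i == h + 1) = (h == i - 1).
    by rewrite -[i == _]subr_eq eq_sym.
  rewrite !pred_eq => + nl nj.
  case/orP: nj nl => /eqP-> /orP[]/eqP->; rewrite ?eqxx // => _.
    by exists true.
  by exists false.
have c_succ i : inl i \in c -> inl (i + 1) \in c.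
  move=> ci; have [[] next_i prev_i] := c_inl i ci.
    by rewrite -next_i mem_next.
  by rewrite -prev_i mem_prev.
have [i0 ci0] : exists i, inl i \in c.
  case: c c_gt2 c_inr {cyc_c uniq_c next_adj prev_adj next_neq c_inl c_succ}.
    by [].
  move=> [i|a] c _ => [_|/(_ a)]; rewrite ?mem_head //.
  by exists i; rewrite mem_head.
(* Starting from [i0], take [i - i0] successor steps. *)
have c_all i : inl i \in c.
  rewrite -[i](subrK i0) -(natr_Zp (i - i0)) addrC.
  elim: (nat_of_ord (i - i0)) => [|l IHl]; first by rewrite addr0.
  by rewrite -natr1 addrA c_succ.
apply/setP=> E; apply/imsetP/imsetP=> [[[i|a] cx ->]|[i _ ->]].
- have [[] next_i _] := c_inl i cx; rewrite next_i; first by exists i.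
  by exists (i - 1); rewrite // subrK finset.setUC.
- by rewrite (negPf (c_inr a)) in cx.
(* If [c] runs backwards at [i], the edge from [i] to [i + 1] is the one leaving [i + 1]. *)
- have [[] next_i prev_i] := c_inl i (c_all i).
    by exists (inl i); rewrite ?next_i.
  exists (inl (i + 1)); rewrite ?c_all // -prev_i next_prev //.
  by rewrite finset.setUC.
Qed.

Lemma sun_unicyclic : unicyclic sun.
Proof.
exists [set [set (inl i : sun); inl (i + 1)] | i in 'I_k.+3].
pose succ (i : 'I_k.+3) := i + 1.
have succ_inj : injective succ by apply: addIr.
(* As an orbit of the successor map, the cycle is duplicate-free with a known [next]. *)
pose c : seq sun := map inl (orbit succ 0).
have mem_orbit i : i \in orbit succ 0.
  rewrite -fconnect_orbit -(natr_Zp i); elim: (nat_of_ord i) => // l IHl.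
  by rewrite (connect_trans IHl) // connect1 //= /succ natr1.
have uniq_c : uniq c by rewrite map_inj_uniq ?orbit_uniq //; apply: inl_inj.
have c_gt2 : (2 < size c)%N.
  rewrite size_map size_orbit /fingraph.order.
  rewrite (@eq_card _ _ predT) ?card_ord // => i.
  by rewrite !inE fconnect_orbit mem_orbit.
have cyc_c : ucycle sun_adj c.
  rewrite /ucycle uniq_c andbT cycle_from_next // => _ /mapP[i _ ->].
  rewrite next_map ?orbit_uniq //; last exact: inl_inj.
  by rewrite (nextE (cycle_orbit succ_inj 0)) ?mem_orbit //= eqxx.
split=> [|C [c' [c'_gt2 cyc_c' ->]]].
  by exists c; split; rewrite ?sun_cycle_edges.
by rewrite sun_cycle_edges.
Qed.

Lemma order_of_sun : order_of sun = (k.+3 + p)%N.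
Proof. by rewrite /order_of cardsT card_sum !card_ord. Qed.

Lemma card_pendant_sun : #|pendant sun| = p.
Proof.
rewrite -sum1_card big_mkcond big_sumType /= big1 => [|i _].
  rewrite add0n -[RHS]card_ord -sum1_card; apply: eq_bigr => a _.
  by rewrite inE deg_sun_inr.
by rewrite inE deg_sun_inl.
Qed.

Lemma If_sun (R : realType) (f : R -> R) :
  If f sun =
    \sum_(i < k.+3) f (2 + \sum_(a < p) (g a == i))%:R + p%:R * f 1.
Proof.
rewrite /If big_sumType /=; congr (_ + _).
  by apply: eq_bigr => i _; rewrite deg_sun_inl.
under eq_bigr do rewrite deg_sun_inr.
by rewrite sumr_const card_ord mulr_natl.
Qed.

End Sun.

(** * Even distribution and the final bounds *)

Lemma sum_eq_mod (q K i : nat) : (i < K)%N ->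
  (\sum_(a < q) (a %% K == i) = q %/ K + (i < q %% K))%N.
Proof.
move=> iK; have K_gt0 := leq_ltn_trans (leq0n i) iK.
elim: q => [|q IHq]; first by rewrite big_ord0 div0n mod0n.
rewrite big_ord_recr /= IHq divnS // modnS.
(* When [K] divides [q + 1], the new term has residue [K - 1] and completes a block: the quotient
   grows and the remainder returns to 0. *)
case: ifP => [dvdKq|_] /=; last first.
  by rewrite add0n -addnA ltnS; case: ltngtP.
have ->: (q %% K = K.-1)%N.
  case/dvdnP: dvdKq => [[//|u]] qE.
  have ->: q = (u * K + K.-1)%N by lia.
  by rewrite modnMDl modn_small // prednK.
by case: (ltngtP i K.-1); lia.
Qed.

Theorem theorem5p3 (R : realType) (n p : nat) (f : R -> R) :
  (4 <= n)%N -> (1 <= p <= n - 3)%N ->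
  concave_function `[2, +oo[%classic f ->
  let m := ((2 * n - p) %/ (n - p))%N in
  let t := (2 * n - p - m * (n - p))%N in
  let lower := f (p + 2)%:R + (n - p - 1)%:R * f 2 + p%:R * f 1 in
  let upper := t%:R * f (m + 1)%:R + (n - p - t)%:R * f m%:R + p%:R * f 1 in
  [/\ forall G : graph, unicyclic G -> order_of G = n -> #|pendant G| = p ->
        lower <= If f G <= upper,
      exists G : graph, [/\ unicyclic G, order_of G = n, #|pendant G| = p
        & If f G = lower]
    & exists G : graph, [/\ unicyclic G, order_of G = n, #|pendant G| = p
        & If f G = upper] ].
Proof.
move=> n_ge4 /andP[p_gt0 p_le] conc_f m t lower upper.
(* The cycle of the extremal graphs has length [n - p], at least 3. *)
have [k nE] : exists k, n = (k.+3 + p)%N.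
  by exists (n - p - 3)%N; lia.
have npE : (n - p = k.+3)%N by rewrite nE addnK.
have n2E : (2 * n - p = 2 * k.+3 + p)%N by lia.
(* As [2n - p = 2(n - p) + p], [m - 2] and [t] are the quotient and remainder of [p] by [n - p]. *)
have mE : m = (2 + p %/ k.+3)%N by rewrite /m npE n2E divnMDl.
have tE : t = (p %% k.+3)%N.
  by rewrite /t n2E mE npE {1}(divn_eq p k.+3) mulnDl addnA addKn.
have t_lt : (t < k.+3)%N by rewrite tE ltn_mod.
split.
- move=> G uni_G order_G pend_G.
  pose P := [pred u : G | deg u != 1%N].
  have card_P : #|P| = k.+3.
    have := cardsC (pendant G); rewrite -cardsT -/(order_of G) order_G pend_G.
    rewrite -[LHS]addnC nE => /addIn <-.
    by apply: eq_card => u; rewrite !inE.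
  (* Stated for any [M] to serve both the degree sum and the sum of values of [f]. *)
  have sum_pend (M : nmodType) (h : nat -> M) :
      \sum_(u | u \notin P) h (deg u) = h 1%N *+ p.
    rewrite -pend_G -sumr_const; apply: eq_big => [u|u].
      by rewrite !inE negbK.
    by rewrite !inE negbK => /eqP->.
  have deg_ge2 u : u \in P -> (2 <= deg u)%N.
    by rewrite inE => deg_u; rewrite ltn_neqAle eq_sym deg_u deg_gt0.
  have sum_P : (\sum_(u in P) deg u = 2 * k.+3 + p)%N.
    have := sum_deg_unicyclic uni_G; rewrite (bigID (mem P)) /= order_G.
    have -> : (\sum_(u | u \notin P) deg u = p)%N.
      by rewrite (sum_pend nat id); apply: natn.
    lia.
  have ->: If f G = \sum_(u in P) f (deg u)%:R + p%:R * f 1.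
    rewrite /If (bigID (mem P)) /= (sum_pend _ (fun d => f d%:R)).
    by rewrite mulr_natl.
  rewrite !lerD2r npE -card_P; apply/andP; split.
    by apply: concave_sum_ge; rewrite ?card_P.
  apply: concave_sum_le => //; first by rewrite mE.
    by rewrite card_P ltnW.
  by rewrite sum_P card_P mE tE mulnDl -addnA -divn_eq.
(* With all pendant vertices at 0, that vertex has degree [p + 2] and the rest of the cycle degree
   2. *)
- exists (sun (fun _ : 'I_p => 0 : 'I_k.+3)); split.
  + exact: sun_unicyclic.
  + by rewrite order_of_sun.
  + exact: card_pendant_sun.
  rewrite If_sun /lower npE subSS subn0; congr (_ + _).
  rewrite big_ord_recl /= sum_nat_const card_ord muln1 addnC; congr (_ + _).
  rewrite (eq_bigr (fun=> f 2)) => [|i _]; last by rewrite big1.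
  by rewrite sumr_const card_ord mulr_natl.
- have K_gt0 : (0 < k.+3)%N by [].
  (* Dealing pendant vertices out by residue gives degree [m + 1] to the first [t] cycle vertices
     and [m] to the others. *)
  exists (sun (fun a : 'I_p => Ordinal (ltn_pmod a K_gt0))); split.
  + exact: sun_unicyclic.
  + by rewrite order_of_sun.
  + exact: card_pendant_sun.
  rewrite If_sun /upper npE; congr (_ + _).
  pose F i := f (m + (i < t))%:R.
  transitivity (\sum_(0 <= i < k.+3) F i).
    rewrite big_mkord; apply: eq_bigr => i _.
    by rewrite sum_eq_mod ?ltn_ord // /F mE tE addnA.
  rewrite (big_cat_nat (n := t)) //=; last exact: ltnW.
  rewrite (@eq_big_nat _ _ _ 0 t F (fun=> f (m + 1)%:R)) => [|i /andP[_ it]].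
    rewrite (@eq_big_nat _ _ _ t k.+3 F (fun=> f m%:R)) => [|i /andP[ti _]].
      by rewrite !sumr_const_nat subn0 !mulr_natl.
    by rewrite /F ltnNge ti addn0.
  by rewrite /F it.
Qed.
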